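(* Let $k$ be an infinite field, let $R$ be a Hensel local $k$-algebra with maximal ideal $\mathfrak m$ and residue field $R/\mathfrak m=k$, and let $p$ be a prime with $p\neq\operatorname{char} k$. Then the natural map $$H_2(PGL_2(k),\mathbb Z/p)\longrightarrow H_2(PGL_2(R),\mathbb Z/p)$$ is an isomorphism.
   Context: Homology is group homology of the discrete groups with trivial coefficients. For a local ring $A$, $PGL_2(A)=GL_2(A)/A^\times$, where $A^\times$ is embedded as scalar matrices. A Hensel local $k$-algebra is a (commutative) $k$-algebra that is a Henselian local ring; $R/\mathfrak m=k$ means that the composite $k\to R\to R/\mathfrak m$ is an isomorphism. The natural map is induced by the structure map $k\to R$. *)

(* Defs.v *)
From HB Require Import structures.
From mathcomp Require Import freeg.
From mathcomp Require Import all_boot all_algebra.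
From mathcomp Require Import zify.
From mathcomp Require Import boolp classical_sets cardinality.

Set Implicit Arguments.
Unset Strict Implicit.
Unset Printing Implicit Defensive.

Import GRing.Theory.

Local Open Scope ring_scope.
Local Open Scope quotient_scope.

(* [freeg] only provides the additivity of the linear extension [fglift h]. *)
Section FgliftLinear.
Variables (A : nzRingType) (K : choiceType) (M : lmodType A) (h : K -> M).

HB.instance Definition _ :=
  GRing.isZmodMorphism.Build {freeg K / A} M (fglift h) (lift_is_additive h).

Lemma fglift_is_scalable : scalable (fglift h : {freeg K / A} -> M).
Proof.
move=> a D; rewrite -[in RHS](freeg_sumE D).
rewrite [a *: D]/(fgscale a D) /fgscale !raddf_sum.
by apply: eq_bigr => x _; rewrite /= !liftU scalerA.
Qed.

HB.instance Definition _ :=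
  GRing.isScalable.Build A {freeg K / A} M *:%R (fglift h) fglift_is_scalable.

End FgliftLinear.

(** * Group homology with trivial coefficients *)

(* The inhomogeneous bar complex: [chain G A n] is the free A-module on the
   symbols [g_0|...|g_(n-1)]. *)
Section BarComplex.
Variables (G : groupType) (A : nzRingType).

(* Face i of [g_0|...|g_n]: drop g_0 if i = 0, drop g_n if i = n + 1, and
   multiply g_(i-1) by g_i otherwise. *)
Definition bar_face n (i : 'I_n.+2) (g : {ffun 'I_n.+1 -> G}) :
    {ffun 'I_n -> G} :=
  [ffun j : 'I_n =>
     if (j.+1 < i)%N then g (widen_ord (leqnSn n) j)
     else if j.+1 == i :> nat
     then (g (widen_ord (leqnSn n) j) * g (lift ord0 j))%g
     else g (lift ord0 j)].

Definition chain n := {freeg {ffun 'I_n -> G} / A}.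
HB.instance Definition _ n := GRing.Lmodule.on (chain n).

Definition bar_diff n : chain n -> chain n.-1 :=
  match n with
  | 0 => fun=> 0
  | m.+1 => fglift (fun g : {ffun 'I_m.+1 -> G} =>
              \sum_(i < m.+2) (-1) ^+ i *: (<< bar_face i g >> : chain m))
  end.
Arguments bar_diff : simpl never.

Lemma bar_diff_is_zmod_morphism n : zmod_morphism (@bar_diff n).
Proof.
by case: n => [|n] x y; [rewrite /bar_diff subr0 | exact: lift_is_additive].
Qed.

HB.instance Definition _ n :=
  GRing.isZmodMorphism.Build (chain n) (chain n.-1) (@bar_diff n)
    (@bar_diff_is_zmod_morphism n).

Lemma bar_faceK n (i j : nat) (i1 j1 : 'I_n.+2) (i2 j2 : 'I_n.+3)
    (g : {ffun 'I_n.+2 -> G}) : (i < j)%N ->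
  i1 = i :> nat -> i2 = i :> nat -> j1 = j.-1 :> nat -> j2 = j :> nat ->
  bar_face i1 (bar_face j2 g) = bar_face j1 (bar_face i2 g).
Proof.
move=> lij e1 e2 e3 e4; apply/ffunP => t; rewrite !ffunE /=.
rewrite {}e1 {}e2 {}e3 {}e4 /bump /=.
have gE (a b : 'I_n.+2) : a = b :> nat -> g a = g b.
  by move=> ab; congr (g _); apply: val_inj.
repeat case: ifP => ?; try (exfalso; lia); rewrite ?mulgA;
  by repeat (congr (_ * _)%g); apply: gE => /=; rewrite /bump; lia.
Qed.

Lemma bar_diffK n (c : chain n.+1) : bar_diff (bar_diff c) = 0.
Proof.
case: n c => [//|n] c.
rewrite -(freeg_sumE c) !raddf_sum big1 // => g _ /=.
rewrite /bar_diff liftU linearZ /= linear_sum /=.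
under eq_bigr => j _ do rewrite linearZ /= liftU scale1r scaler_sumr.
pose T : finType := ('I_n.+3 * 'I_n.+2)%type.
rewrite pair_big /=; set F := fun p : T =>
  (-1) ^+ p.1 *: ((-1) ^+ p.2 *: << bar_face p.2 (bar_face p.1 g) >>) : chain n.
rewrite -[X in _ *: X]/(\sum_(p : T) F p).
pose P (p : T) := (p.2 < p.1)%N.
pose s (p : T) : T :=
  if P p then (inord p.2, inord p.1.-1) else (inord p.2.+1, inord p.1).
have sE p : s p =
  if P p then (inord p.2, inord p.1.-1) else (inord p.2.+1, inord p.1) by [].
have sK : involutive s.
  move=> [i j]; have := ltn_ord i; have := ltn_ord j => hj hi.
  rewrite [s (i, j)]sE /P /=; case: ifP => ij; rewrite sE /P /= !inordK;
    try lia; [rewrite ifF; last by lia | rewrite ifT; last by lia];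
    by congr (_, _); apply: val_inj; rewrite /= inordK; lia.
rewrite (bigID P) /= [X in _ + X](reindex_inj (inv_inj sK)) /=.
rewrite [X in _ + X](eq_bigl P); last first.
  move=> [i j]; have := ltn_ord i; have := ltn_ord j => hj hi.
  by rewrite sE /P /=; case: ifP => /= ij; rewrite !inordK; lia.
rewrite -big_split big1 ?scaler0 //= => -[j i] ij.
have := ltn_ord i; have := ltn_ord j => hj hi.
rewrite sE ij /F /=; rewrite /P /= in ij.
rewrite (@bar_faceK n i j i (inord j.-1) (inord i) j) ?inordK //; try lia.
rewrite !scalerA -!exprD -scalerDl.
have -> : (j + i)%N = (i + j.-1).+1 by lia.
by rewrite exprS mulN1r addNr scale0r.
Qed.

Definition is_cycle n : {pred chain n} := [pred c | bar_diff c == 0].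

Lemma is_cycle_zmod_closed n : zmod_closed (@is_cycle n).
Proof.
split=> [|x y]; rewrite !inE ?raddf0 // => /eqP dx /eqP dy.
by rewrite raddfB /= dx dy subr0.
Qed.

HB.instance Definition _ n :=
  GRing.isZmodClosed.Build (chain n) (@is_cycle n) (@is_cycle_zmod_closed n).

Record cycle n := Cycle {cycle_val :> chain n; _ : cycle_val \in @is_cycle n}.

HB.instance Definition _ n := [isSub for @cycle_val n].
HB.instance Definition _ n := [Choice of cycle n by <:].
HB.instance Definition _ n := [SubChoice_isSubZmodule of cycle n by <:].

Definition is_boundary n : {pred cycle n} :=
  [pred z : cycle n | `[< exists b : chain n.+1, bar_diff b = val z >]].

Lemma is_boundary_zmod_closed n : zmod_closed (@is_boundary n).
Proof.
split=> [|x y]; rewrite !inE.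
  by exists 0; rewrite !raddf0.
by move=> [b db] [c dc]; exists (b - c); rewrite !raddfB /= db dc.
Qed.

HB.instance Definition _ n :=
  GRing.isZmodClosed.Build (cycle n) (@is_boundary n)
    (@is_boundary_zmod_closed n).

Definition homology n := {ideal_quot (@is_boundary n)}.
HB.instance Definition _ n := GRing.Zmodule.on (homology n).

Lemma homology_piP n (x y : cycle n) :
  \pi_(homology n) x = \pi_(homology n) y <->
  exists b : chain n.+1, bar_diff b = (x : chain n) - (y : chain n).
Proof.
rewrite (rwP eqP) -[_ == _]Quotient.idealrBE inE.
by split=> -[b db]; exists b; rewrite db raddfB.
Qed.

End BarComplex.

Section InducedMap.
Variables (A : nzRingType) (G H : groupType) (f : {multiplicative G -> H}).

Definition chain_map n : chain G A n -> chain H A n :=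
  fglift (fun g : {ffun 'I_n -> G} =>
            (<< [ffun i => f (g i)] >> : chain H A n)).

Lemma chain_map_is_zmod_morphism n : zmod_morphism (@chain_map n).
Proof. exact: lift_is_additive. Qed.

HB.instance Definition _ n :=
  GRing.isZmodMorphism.Build (chain G A n) (chain H A n) (@chain_map n)
    (@chain_map_is_zmod_morphism n).

Lemma chain_map_bar_diff n (c : chain G A n) :
  chain_map (bar_diff c) = bar_diff (chain_map c).
Proof.
case: n c => [|n] c; first by rewrite [bar_diff c]/(0) raddf0.
rewrite -(freeg_sumE c) !raddf_sum; apply: eq_bigr => g _ /=.
rewrite /bar_diff /chain_map !liftU !linearZ /= liftU scale1r; congr (_ *: _).
rewrite linear_sum; apply: eq_bigr => i _.
rewrite /= linearZ /= liftU scale1r; congr (_ *: << _ >>).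
apply/ffunP => j; rewrite !ffunE.
by case: ifP => // _; case: ifP => // _; rewrite gmulfM.
Qed.

Lemma chain_map_cycle n (z : cycle G A n) : chain_map z \in @is_cycle H A n.
Proof.
rewrite inE -chain_map_bar_diff; case: z => z /= /[!inE] /eqP ->.
by rewrite raddf0.
Qed.

Definition cycle_map n (z : cycle G A n) : cycle H A n :=
  Cycle (chain_map_cycle z).

Definition homology_map n : homology G A n -> homology H A n :=
  fun x => \pi_(homology H A n) (cycle_map (repr x)).

Lemma homology_map_pi n (z : cycle G A n) :
  homology_map (\pi_(homology G A n) z) = \pi_(homology H A n) (cycle_map z).
Proof.
rewrite /homology_map.
have := reprK (\pi_(homology G A n) z); move: (repr _) => y.
move=> /homology_piP[b db]; apply/homology_piP; exists (chain_map b).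
by rewrite -chain_map_bar_diff db raddfB.
Qed.

Lemma homology_map_is_zmod_morphism n : zmod_morphism (@homology_map n).
Proof.
elim/quotW=> x; elim/quotW=> y.
rewrite -raddfB !homology_map_pi -raddfB; congr (\pi _).
by apply: val_inj; rewrite /= !raddfB.
Qed.

HB.instance Definition _ n :=
  GRing.isZmodMorphism.Build (homology G A n) (homology H A n)
    (@homology_map n) (@homology_map_is_zmod_morphism n).

End InducedMap.
Arguments homology_map A {G H} f n.

(** * General and projective linear groups *)

Section GeneralLinear.
Variables (n : nat) (R : comUnitRingType).

Record GL := MkGL {GL_val :> 'M[R]_n; _ : GL_val \in unitmx}.

HB.instance Definition _ := [isSub for GL_val].
HB.instance Definition _ := [Choice of GL by <:].

Lemma GL_unitmx (g : GL) : GL_val g \in unitmx. Proof. exact: valP. Qed.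

Lemma GL_mul_subproof (g h : GL) : g *m h \in unitmx.
Proof. by rewrite unitmx_mul !GL_unitmx. Qed.

Lemma GL_inv_subproof (g : GL) : invmx g \in unitmx.
Proof. by rewrite unitmx_inv GL_unitmx. Qed.

Definition GL_one : GL := MkGL (unitmx1 R n).
Definition GL_mul (g h : GL) : GL := MkGL (GL_mul_subproof g h).
Definition GL_inv (g : GL) : GL := MkGL (GL_inv_subproof g).

Lemma GL_mulA : associative GL_mul.
Proof. by move=> g h k; apply: val_inj; exact: mulmxA. Qed.

Lemma GL_mul1 : left_id GL_one GL_mul.
Proof. by move=> g; apply: val_inj; exact: mul1mx. Qed.

Lemma GL_mulr1 : right_id GL_one GL_mul.
Proof. by move=> g; apply: val_inj; exact: mulmx1. Qed.

Lemma GL_mulV : left_inverse GL_one GL_inv GL_mul.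
Proof. by move=> g; apply/val_inj/mulVmx/GL_unitmx. Qed.

Lemma GL_mulrV : right_inverse GL_one GL_inv GL_mul.
Proof. by move=> g; apply/val_inj/mulmxV/GL_unitmx. Qed.

HB.instance Definition _ :=
  isGroup.Build GL GL_mulA GL_mul1 GL_mulr1 GL_mulV GL_mulrV.

Lemma GL_valM (g h : GL) : GL_val (g * h)%g = GL_val g *m GL_val h.
Proof. by []. Qed.

Lemma GL_valV (g : GL) : GL_val g^-1%g = invmx (GL_val g).
Proof. by []. Qed.

(* Equality in GL_n(R) modulo the scalar matrices a%:M with a a unit of R. *)
Definition scalar_equiv (g h : GL) : bool :=
  `[< exists2 a : R, a \is a GRing.unit & GL_val g = a *: GL_val h >].

Lemma scalar_equivP : equiv_class_of scalar_equiv.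
Proof.
split=> [g|g h|h g k].
- by apply/asboolP; exists 1; rewrite ?unitr1 ?scale1r.
- apply/asboolP/asboolP => -[a Ua ->]; exists a^-1;
  by rewrite ?unitrV // scalerA mulVr // scale1r.
- move=> /asboolP[a Ua gh] /asboolP[b Ub hk]; apply/asboolP.
  by exists (a * b); rewrite ?unitrM ?Ua // gh hk scalerA.
Qed.

Canonical scalar_equiv_rel := EquivRelPack scalar_equivP.
Canonical scalar_equiv_enc := defaultEncModRel scalar_equiv.

Definition PGL := {eq_quot scalar_equiv}.

HB.instance Definition _ := EqQuotient.on PGL.
HB.instance Definition _ := Choice.on PGL.

Lemma PGL_piP (g h : GL) :
  \pi_PGL g = \pi_PGL h <->
  exists2 a : R, a \is a GRing.unit & GL_val g = a *: GL_val h.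
Proof. by rewrite (rwP eqP) eqmodE; split=> /asboolP. Qed.

Definition PGL_one : PGL := \pi_PGL 1%g.
Definition PGL_mul (x y : PGL) : PGL := \pi_PGL (repr x * repr y)%g.
Definition PGL_inv (x : PGL) : PGL := \pi_PGL (repr x)^-1%g.

Lemma pi_PGL_mul (g h : GL) :
  PGL_mul (\pi_PGL g) (\pi_PGL h) = \pi_PGL (g * h)%g.
Proof.
rewrite /PGL_mul; case: piP => g' /PGL_piP[a Ua eg].
case: piP => h' /PGL_piP[b Ub eh]; apply/esym/PGL_piP.
exists (a * b); first by rewrite unitrM Ua.
by rewrite !GL_valM eg eh -scalemxAl -scalemxAr scalerA.
Qed.

Lemma pi_PGL_inv (g : GL) : PGL_inv (\pi_PGL g) = \pi_PGL g^-1%g.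
Proof.
rewrite /PGL_inv; case: piP => g' /PGL_piP[a Ua eg].
apply/PGL_piP; exists a => //; rewrite !GL_valV eg invmxZ.
  by rewrite scalerA mulrV // scale1r.
by rewrite -eg GL_unitmx.
Qed.

Lemma PGL_mulA : associative PGL_mul.
Proof.
move=> x y z; elim/quotW: x => x; elim/quotW: y => y; elim/quotW: z => z.
by rewrite (pi_PGL_mul y z) (pi_PGL_mul x y) !pi_PGL_mul mulgA.
Qed.

Lemma PGL_mul1 : left_id PGL_one PGL_mul.
Proof. by move=> x; elim/quotW: x => x; rewrite pi_PGL_mul mul1g. Qed.

Lemma PGL_mulr1 : right_id PGL_one PGL_mul.
Proof. by move=> x; elim/quotW: x => x; rewrite pi_PGL_mul mulg1. Qed.

Lemma PGL_mulV : left_inverse PGL_one PGL_inv PGL_mul.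
Proof.
by move=> x; elim/quotW: x => x; rewrite pi_PGL_inv pi_PGL_mul mulVg.
Qed.

Lemma PGL_mulrV : right_inverse PGL_one PGL_inv PGL_mul.
Proof.
by move=> x; elim/quotW: x => x; rewrite pi_PGL_inv pi_PGL_mul mulgV.
Qed.

HB.instance Definition _ :=
  isGroup.Build PGL PGL_mulA PGL_mul1 PGL_mulr1 PGL_mulV PGL_mulrV.

Lemma PGL_piM (g h : GL) : (\pi_PGL g * \pi_PGL h)%g = \pi_PGL (g * h)%g.
Proof. exact: pi_PGL_mul. Qed.

End GeneralLinear.

Section LinearGroupMaps.
Variables (n : nat) (R S : comUnitRingType) (f : {rmorphism R -> S}).

Lemma GL_map_subproof (g : GL n R) : map_mx f g \in unitmx.
Proof. by rewrite unitmxE det_map_mx rmorph_unit // -unitmxE GL_unitmx. Qed.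

Definition GL_map (g : GL n R) : GL n S := MkGL (GL_map_subproof g).

Definition PGL_map : PGL n R -> PGL n S :=
  fun x => \pi_(PGL n S) (GL_map (repr x)).

Lemma PGL_map_pi (g : GL n R) :
  PGL_map (\pi_(PGL n R) g) = \pi_(PGL n S) (GL_map g).
Proof.
rewrite /PGL_map.
have := reprK (\pi_(PGL n R) g); move: (repr _) => h /PGL_piP[a Ua eg].
apply/PGL_piP; exists (f a); first exact: rmorph_unit.
by rewrite /= eg map_mxZ.
Qed.

Lemma PGL_map1 : PGL_map 1%g = 1%g.
Proof.
rewrite [LHS](PGL_map_pi 1%g); congr (\pi_(PGL n S) _).
by apply: val_inj; exact: map_mx1.
Qed.

Lemma PGL_mapM : {morph PGL_map : x y / (x * y)%g}.
Proof.
move=> x y; elim/quotW: x => x; elim/quotW: y => y.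
rewrite PGL_piM !PGL_map_pi PGL_piM; congr (\pi_(PGL n S) _).
by apply: val_inj; exact: map_mxM.
Qed.

HB.instance Definition _ :=
  isMultiplicative.Build (PGL n R) (PGL n S) PGL_map PGL_mapM.
HB.instance Definition _ :=
  Multiplicative_isUMagmaMorphism.Build (PGL n R) (PGL n S) PGL_map PGL_map1.

End LinearGroupMaps.
Arguments PGL_map n {R S} f.

(** * Henselian local rings *)

(* [idealr_closed] includes properness.  Ideals are boolean predicates; by
   excluded middle this is no restriction. *)
Definition maximal_ideal (R : comNzRingType) (I : {pred R}) : Prop :=
  idealr_closed I /\
  forall J : {pred R}, idealr_closed J -> {subset I <= J} -> J =i I.

Definition local_ring (R : comNzRingType) (m : {pred R}) : Prop :=
  maximal_ideal m /\ forall J : {pred R}, maximal_ideal J -> J =i m.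

(* [m] is the maximal ideal; simple roots in the residue field of monic
   polynomials over R lift to R. *)
Definition henselian_local_ring (R : comNzRingType) (m : idealr R) : Prop :=
  local_ring m /\
  forall (F : {poly R}) (x0 : {ideal_quot m}),
    let F0 := map_poly \pi_{ideal_quot m} F in
    F \is monic -> root F0 x0 -> ~~ root F0^`() x0 ->
    exists2 x : R, root F x & \pi_{ideal_quot m} x = x0.

(* Main.v *)
(** Injectivity: R -> R/m = k is a retraction of k -> R.

    Surjectivity: let M be the quotient of the 2-chains of PGL_2(R) by the
    boundaries and the chains coming from PGL_2(k).  The cocycle
    (g, h) |-> [g|h] in M defines a central extension E of PGL_2(R) by a group
    killed by p, which is split over PGL_2(k); a section of E over all of
    PGL_2(R) shows that every 2-cycle vanishes in M, hence is homologous to a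
    cycle of PGL_2(k).

    To build the section, note that in E the p-th power of a lift of g depends
    only on g.  As p is invertible in R and, by Hensel, 1 + m is uniquely
    p-divisible, this gives canonical, hence conjugation-equivariant, lifts of
    the unipotent group R and of 1 + m; together with the splitting over
    PGL_2(k) they lift the big cell U T w U.  Conjugation by T reduces
    the multiplicativity of this lift to the relation
    w u(1) w = u(1) h(-1) w u(1), which holds over k.  Since k is infinite,
    finitely many translates of the big cell always meet, so the partial
    homomorphism on the big cell extends to the whole group. *)

Require Import Defs.
From HB Require Import structures.
From mathcomp Require Import freeg.
From mathcomp Require Import all_boot all_algebra.
From mathcomp Require Import ring.
From mathcomp Require Import boolp classical_sets cardinality.

Set Implicit Arguments.
Unset Strict Implicit.
Unset Printing Implicit Defensive.

Import GRing.Theory.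

Local Open Scope ring_scope.
Local Open Scope quotient_scope.

(** * Extending a generically defined homomorphism *)

Section GroupChunk.
Local Open Scope group_scope.
Variables (G E : groupType) (X : G -> Prop) (S : G -> E).
Hypothesis SM : forall x y, X x -> X y -> X (x * y) -> S (x * y) = S x * S y.
Hypothesis X_generic :
  forall a b c, exists h, [/\ X h, X (a * h), X (b * h) & X (c * h)].

(** For generic [h] the elements [h], [g * h], [x^-1 * h] and [y^-1 * h] all lie in [X]. Factoring
    [h] as [x * (x^-1 * h)], and likewise with [y], shows that both sides equal
    [S (g * h) / S h]. *)
Lemma chunk_quotient g x y : X x -> X y -> X (g * x) -> X (g * y) ->
  S (g * x) / S x = S (g * y) / S y.
Proof.
have [h [Xh Xgh Xxh Xyh]] := X_generic g x^-1 y^-1.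
suff chg z : X z -> X (g * z) -> X (z^-1 * h) ->
    S (g * z) / S z = S (g * h) / S h.
  by move=> Xx Xy Xgx Xgy; rewrite (chg x) // (chg y).
move=> Xz Xgz Xzh.
have eS : S h = S z * S (z^-1 * h) by rewrite -SM ?mulVKg.
have eg : S (g * h) = S (g * z) * S (z^-1 * h).
  by rewrite -SM -?mulgA ?mulVKg.
by rewrite eS eg mulgKA.
Qed.

(** By independence of [h], the quotient defines [f g]. For an [h] generic for both [g'] and
    [g * g'], the quotients computing [f g] (at [g' * h]) and [f g'] (at [h]) telescope. *)
Lemma group_chunk : exists f : G -> E, {morph f : x y / x * y} /\
  forall g h, X h -> X (g * h) -> f g = S (g * h) / S h.
Proof.
have [f fE] : exists f : G -> E,
    forall g h, X h -> X (g * h) -> f g = S (g * h) / S h.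
  suff /choice[f fE] : forall g, exists e : E,
      forall h, X h -> X (g * h) -> e = S (g * h) / S h by exists f.
  move=> g; have [h [Xh Xgh _ _]] := X_generic g 1 1.
  by exists (S (g * h) / S h) => x Xx Xgx; exact: chunk_quotient.
exists f; split=> // g g'.
have [h [Xh Xgh Xggh _]] := X_generic g' (g * g') 1.
rewrite (fE _ h) // (fE g (g' * h)) ?(fE g' h) ?mulgA //.
by rewrite mulgVK.
Qed.
End GroupChunk.

(** * Central extensions with kernel killed by p *)

Section CentralExtension.
Local Open Scope group_scope.
Variables (G E : groupType) (pr : UMagmaMorphism.type E G) (p : nat).
Variable l : G -> E.
Hypothesis lK : cancel l pr.
Hypothesis ker_central : forall z e, pr z = 1 -> commute z e.
Hypothesis ker_torsion : forall z, pr z = 1 -> z ^+ p = 1.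

(* Two lifts of g differ by a central element killed by p, so the p-th power
   of a lift is canonical; in particular it is equivariant under conjugation. *)
Definition lift_pow (g : G) : E := l g ^+ p.

Lemma lift_powE e : e ^+ p = lift_pow (pr e).
Proof.
have z1 : pr (e / l (pr e)) = 1 by rewrite gmulfF lK mulgV.
rewrite -[in LHS](mulgVK (l (pr e)) e) expgMn; last exact: ker_central.
by rewrite (ker_torsion z1) mul1g.
Qed.

Lemma pr_lift_pow g : pr (lift_pow g) = g ^+ p.
Proof. by rewrite gmulfXn lK. Qed.

Lemma lift_powJ g e : lift_pow g ^ e = lift_pow (g ^ pr e).
Proof. by rewrite conjXg lift_powE gmulfJ lK. Qed.

(** Lifts of commuting elements commute only up to the kernel. But [lift_pow g] is a lift of
    [g ^+ p] fixed under conjugation by [l h], so the p-th power of [lift_pow g * l h] splits; hence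
    the [g ^+ p] in the statement. *)
Lemma lift_powM g h : commute g h -> lift_pow (g ^+ p * h) =
  lift_pow (g ^+ p) * lift_pow h.
Proof.
move=> gh; set x := lift_pow g.
have xh : commute x (l h).
  by apply/commgP/conjg_fixP; rewrite lift_powJ lK conjgE gh mulKg.
rewrite -[g ^+ p]pr_lift_pow -/x -{1}[h]lK -gmulfM -!lift_powE expgMn //.
Qed.

(** Conjugation equivariance in the form that carries relations from [G] to [E]; [e] matters only
    through its projection. *)
Lemma lift_pow_intertwine e g g' : pr e * g = g' * pr e ->
  e * lift_pow g = lift_pow g' * e.
Proof.
by move=> eg; rewrite [RHS]conjgC lift_powJ conjgE -eg mulKg.
Qed.

Lemma lift_pow1 : lift_pow 1 = 1.
Proof. by have := lift_powE 1; rewrite expg1n gmulf1 => <-. Qed.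

End CentralExtension.

(** * Homology in degree two and central extensions *)

Lemma freeg_basisE (A : nzRingType) (K : choiceType) (c : {freeg K / A}) :
  c = \sum_(x <- dom c) coeff x c *: << x >>.
Proof.
rewrite -[LHS]freeg_sumE; apply: eq_bigr => x _; apply/eqP/freeg_eqP => y.
by rewrite coeffZ !coeffU mul1r.
Qed.

Lemma bar_diffZ (G : groupType) (A : nzRingType) n a (c : chain G A n) :
  bar_diff (a *: c) = a *: bar_diff c.
Proof.
by case: n c => [|n] c; [rewrite scaler0 | rewrite /bar_diff linearZ].
Qed.

Lemma chain_mapK (A : nzRingType) (G H : groupType)
    (i : {multiplicative G -> H}) (r : {multiplicative H -> G}) n :
  cancel i r -> cancel (@chain_map A _ _ i n) (@chain_map A _ _ r n).
Proof.
move=> iK c; rewrite [c in RHS]freeg_basisE [c in LHS]freeg_basisE !raddf_sum.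
apply: eq_bigr => g _ /=; rewrite /chain_map.
rewrite linearZ /= liftU scale1r linearZ /= liftU scale1r.
by congr (_ *: << _ >>); apply/ffunP => j; rewrite !ffunE iK.
Qed.

(** The chain map of the retraction [r] carries a bounding chain over [H] back to one over [G]. *)
Lemma homology_map_inj (A : nzRingType) (G H : groupType)
    (i : {multiplicative G -> H}) (r : {multiplicative H -> G}) n :
  cancel i r -> injective (homology_map A i n).
Proof.
move=> iK; elim/quotW=> x; elim/quotW=> y; rewrite !homology_map_pi.
move=> /homology_piP[b db]; apply/homology_piP; exists (chain_map r b).
by rewrite -chain_map_bar_diff db raddfB /= !chain_mapK.
Qed.

(** * The 2-chains modulo relations and their tautological cocycle *)

Section TautologicalCocycle.
Variables (A : nzRingType) (G' G : groupType) (i : {multiplicative G' -> G}).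

(** Here [d] runs over all 2-chains of [G'], not only cycles, so that the cocycle vanishes
    identically on [G']. *)
Definition is_relation : {pred chain G A 2} :=
  [pred c | `[< exists b : chain G A 3, exists d : chain G' A 2,
                  c = bar_diff b + chain_map i d >]].

Lemma is_relation_zmod_closed : zmod_closed is_relation.
Proof.
split=> [|x y]; rewrite !inE.
  by exists 0, 0; rewrite !raddf0 addr0.
move=> [b [d ->]] [b' [d' ->]]; exists (b - b'), (d - d').
by rewrite !raddfB opprD addrACA.
Qed.

HB.instance Definition _ :=
  GRing.isZmodClosed.Build (chain G A 2) is_relation is_relation_zmod_closed.

Lemma is_relationZ a c : c \in is_relation -> a *: c \in is_relation.
Proof.
rewrite !inE => -[b [d ->]]; exists (a *: b), (a *: d).
by rewrite bar_diffZ /chain_map linearZ scalerDr.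
Qed.

Definition relquot := {ideal_quot is_relation}.
HB.instance Definition _ := GRing.Zmodule.on relquot.

Lemma relquot_pi0 c : \pi_relquot c = 0 <-> c \in is_relation.
Proof.
rewrite -[c in X in _ <-> X]subr0 Quotient.idealrBE -(rwP eqP).
by rewrite -[X in _ <-> _ = X]/(\pi_relquot 0) raddf0.
Qed.

Definition sym1 (g : G) : chain G A 1 := << [ffun=> g] >>.
Definition sym2 (g h : G) : chain G A 2 :=
  << [ffun j : 'I_2 => if j == 0 then g else h] >>.

Lemma bar_diff_sym2 g h :
  bar_diff (sym2 g h) = sym1 h - sym1 (g * h)%g + sym1 g.
Proof.
rewrite /bar_diff liftU scale1r !big_ord_recl big_ord0 /= addr0.
rewrite expr0 expr1 scale1r scaleN1r -signr_odd expr0 scale1r addrA.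
by congr (_ - _ + _); congr (<< _ >>); apply/ffunP => j;
  rewrite !ffunE (ord1 j).
Qed.

Definition cocycle g h : relquot := \pi_relquot (sym2 g h).

Lemma cocycle_eq f g h :
  cocycle f g + cocycle (f * g)%g h = cocycle f (g * h)%g + cocycle g h.
Proof.
apply/eqP; rewrite -!raddfD -[_ == _]Quotient.idealrBE inE.
(* The two sides differ by minus the boundary of [f|g|h]; the component from [G'] is 0. *)
exists (- << [ffun j : 'I_3 => nth 1%g [:: f; g; h] j] >>), 0.
rewrite raddf0 addr0 raddfN /= /bar_diff liftU scale1r.
rewrite !big_ord_recl big_ord0 /= addr0.
rewrite -[in X in _ = - X]signr_odd expr0 expr1 !scale1r scaleN1r.
rewrite -(signr_odd _ (bump 0 (bump 0 0))).
rewrite -(signr_odd _ (bump 0 (bump 0 (bump 0 0)))) /= expr0 expr1.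
rewrite !scale1r scaleN1r.
have -> : bar_face ord0 [ffun j : 'I_3 => ([:: f; g; h]`_j)%g] =
    [ffun j : 'I_2 => if j == 0 then g else h].
  by apply/ffunP => -[[|[|//]] lj]; rewrite !ffunE.
have -> : bar_face (lift ord0 ord0) [ffun j : 'I_3 => ([:: f; g; h]`_j)%g] =
    [ffun j : 'I_2 => if j == 0 then (f * g)%g else h].
  by apply/ffunP => -[[|[|//]] lj]; rewrite !ffunE.
have -> : bar_face (lift ord0 (lift ord0 ord0))
      [ffun j : 'I_3 => ([:: f; g; h]`_j)%g] =
    [ffun j : 'I_2 => if j == 0 then f else (g * h)%g].
  by apply/ffunP => -[[|[|//]] lj]; rewrite !ffunE.
have -> : bar_face (lift ord0 (lift ord0 (lift ord0 ord0)))
      [ffun j : 'I_3 => ([:: f; g; h]`_j)%g] =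
    [ffun j : 'I_2 => if j == 0 then f else g].
  by apply/ffunP => -[[|[|//]] lj]; rewrite !ffunE.
rewrite -/(sym2 _ _) -/(sym2 f g) -/(sym2 f (g * h)%g) -/(sym2 (f * g)%g h).
rewrite !opprD !opprK [- _ + sym2 f g]addrC [X in _ = _ + X]addrCA [RHS]addrC.
by rewrite !addrA.
Qed.

Lemma cocycle_image g h : cocycle (i g) (i h) = 0.
Proof.
apply/relquot_pi0; rewrite inE.
exists 0, << [ffun j : 'I_2 => if j == 0 then g else h] >>.
rewrite raddf0 add0r /chain_map liftU scale1r; congr (<< _ >>).
by apply/ffunP => j; rewrite !ffunE; case: ifP.
Qed.

End TautologicalCocycle.

(** * The central extension defined by the tautological cocycle *)

Section TautologicalExtension.
Local Open Scope group_scope.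
Variables (A : nzRingType) (G' G : groupType) (i : UMagmaMorphism.type G' G).

Local Notation M := (relquot A i).
Local Notation coc := (cocycle A i).

(** The cocycle identity reduces this to [coc 1 1], which vanishes because 1 is in the image of [i];
    so the cocycle is normalised although the bar complex is not. *)
Lemma cocycle1g g : coc 1 g = 0%R.
Proof.
have := cocycle_eq A i 1 1 g; rewrite !mul1g => /addIr <-.
by rewrite -(gmulf1 (s := i)) cocycle_image.
Qed.

Lemma cocycleg1 g : coc g 1 = 0%R.
Proof.
have := cocycle_eq A i g 1 1; rewrite !mulg1 => /addrI ->.
by rewrite -(gmulf1 (s := i)) cocycle_image.
Qed.

Definition taut_ext : Type := (M * G)%type.
HB.instance Definition _ := Choice.on taut_ext.

Definition taut_ext_mul (x y : taut_ext) : taut_ext :=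
  ((x.1 + y.1 + coc x.2 y.2)%R, x.2 * y.2).
Definition taut_ext_one : taut_ext := (0%R, 1).
Definition taut_ext_inv (x : taut_ext) : taut_ext :=
  ((- x.1 - coc x.2^-1 x.2)%R, x.2^-1).

Lemma taut_ext_mulA : associative taut_ext_mul.
Proof.
move=> [a f] [b g] [c h]; rewrite /taut_ext_mul /= mulgA; congr (_, _).
rewrite -!addrA; do 2 congr (_ + _)%R.
rewrite [(coc g h + _)%R]addrC -cocycle_eq [RHS]addrCA; congr (_ + _)%R.
Qed.

Lemma taut_ext_mul1 : left_id taut_ext_one taut_ext_mul.
Proof.
by move=> [a g]; rewrite /taut_ext_mul /= mul1g cocycle1g add0r addr0.
Qed.

Lemma taut_ext_mulr1 : right_id taut_ext_one taut_ext_mul.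
Proof.
by move=> [a g]; rewrite /taut_ext_mul /= mulg1 cocycleg1 !addr0.
Qed.

Lemma taut_ext_mulV : left_inverse taut_ext_one taut_ext_inv taut_ext_mul.
Proof.
move=> [a g]; rewrite /taut_ext_mul /= mulVg; congr (_, _).
by rewrite addrAC subrK addNr.
Qed.

Lemma taut_ext_mulrV : right_inverse taut_ext_one taut_ext_inv taut_ext_mul.
Proof.
move=> [a g]; rewrite /taut_ext_mul /= mulgV; congr (_, _).
have := cocycle_eq A i g g^-1 g.
rewrite mulgV mulVg cocycle1g cocycleg1 addr0 add0r => ->.
by rewrite addrA subrr add0r addNr.
Qed.

HB.instance Definition _ :=
  isGroup.Build taut_ext taut_ext_mulA taut_ext_mul1 taut_ext_mulr1
    taut_ext_mulV taut_ext_mulrV.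

Definition taut_ext_pr (x : taut_ext) : G := x.2.

Lemma taut_ext_prM : {morph taut_ext_pr : x y / x * y}. Proof. by []. Qed.

HB.instance Definition _ :=
  isMultiplicative.Build taut_ext G taut_ext_pr taut_ext_prM.
HB.instance Definition _ :=
  Multiplicative_isUMagmaMorphism.Build taut_ext G taut_ext_pr (erefl _).

Definition taut_ext_lift (g : G) : taut_ext := (0%R, g).
Lemma taut_ext_liftK : cancel taut_ext_lift taut_ext_pr. Proof. by []. Qed.

Definition taut_ext_split (g : G') : taut_ext := (0%R, i g).

Lemma taut_ext_splitM : {morph taut_ext_split : x y / x * y}.
Proof.
move=> g h; rewrite /taut_ext_split gmulfM.
by rewrite -[RHS]/(taut_ext_mul _ _) /taut_ext_mul /= cocycle_image !addr0.
Qed.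

Lemma taut_ext_split1 : taut_ext_split 1 = 1.
Proof. by rewrite /taut_ext_split gmulf1. Qed.

HB.instance Definition _ :=
  isMultiplicative.Build G' taut_ext taut_ext_split taut_ext_splitM.
HB.instance Definition _ :=
  Multiplicative_isUMagmaMorphism.Build G' taut_ext taut_ext_split
    taut_ext_split1.

Lemma taut_ext_ker_central (z e : taut_ext) : taut_ext_pr z = 1 -> commute z e.
Proof.
case: z e => [a _] [b g] /= ->.
rewrite /commute -[LHS]/(taut_ext_mul _ _) -[RHS]/(taut_ext_mul _ _).
by rewrite /taut_ext_mul /= mulg1 mul1g cocycle1g cocycleg1 [(a + b)%R]addrC.
Qed.

Lemma taut_ext_ker_torsion p (z : taut_ext) : (p%:R = 0 :> A)%R ->
  taut_ext_pr z = 1 -> z ^+ p = 1.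
Proof.
case: z => [a _] p0 /= ->.
have -> : ((a, 1) : taut_ext) ^+ p = ((a *+ p)%R, 1).
  elim: p {p0} => [|n IHn]; first by rewrite mulr0n.
  rewrite expgS IHn -[LHS]/(taut_ext_mul _ _) /taut_ext_mul /= mulg1 cocycle1g.
  by rewrite addr0 mulrS.
elim/quotW: a => c; rewrite -raddfMn.
have -> : (c *+ p = 0)%R by rewrite -scaler_nat p0 scale0r.
by rewrite raddf0.
Qed.

End TautologicalExtension.

(* A section of the tautological extension trivialises the tautological
   cocycle, which turns every 2-cycle into a relation. *)
Lemma homology2_surjective (A : nzRingType) (p : nat) (G' G : groupType)
    (i : UMagmaMorphism.type G' G) (r : {multiplicative G -> G'}) :
    cancel i r -> (p%:R = 0 :> A)%R ->
    (forall (E : groupType) (pr : UMagmaMorphism.type E G) (l : G -> E)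
       (s : UMagmaMorphism.type G' E),
       cancel l pr ->
       (forall z e : E, pr z = 1%g -> commute z e) ->
       (forall z : E, pr z = 1%g -> (z ^+ p)%g = 1%g) ->
       (forall g, pr (s g) = i g) ->
       exists2 f : G -> E, {morph f : x y / (x * y)%g} & cancel f pr) ->
  forall y, exists x, homology_map A i 2 x = y.
Proof.
move=> iK p0 spl y.
have [||||f fM fK] := spl (taut_ext A i) (@taut_ext_pr A _ _ i)
  (@taut_ext_lift A _ _ i) (@taut_ext_split A _ _ i).
- exact: taut_ext_liftK.
- exact: taut_ext_ker_central.
- by move=> z; exact: taut_ext_ker_torsion.
- by [].
(* [F] sends [g] to a chain representing the [M]-component of [f g]. *)
pose F : {linear chain G A 1 -> chain G A 2} :=
  fglift (fun x : {ffun 'I_1 -> G} => repr (f (x ord0)).1 : chain G A 2).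
have piF g : \pi_(relquot A i) (F (sym1 A g)) = (f g).1.
  by rewrite [F _]liftU scale1r ffunE reprK.
(* Multiplicativity of [f] says that modulo relations [F] of the boundary of [g|h] is minus the
   cocycle, that is, minus the class of [g|h]. On cycles the [F] term disappears. *)
have relF (c : chain G A 2) : c + F (bar_diff c) \in is_relation i.
  rewrite [c]freeg_basisE.
  elim/big_ind: (\sum_(_ <- _) _).
  - by rewrite !raddf0 addr0 rpred0.
  - by move=> d e dR eR; rewrite !raddfD addrACA rpredD.
  move=> x _; rewrite bar_diffZ [F _]linearZ -[X in X \in _]scalerDr.
  apply: is_relationZ; apply/relquot_pi0; set g := x ord0; set h := x ord_max.
  have -> : << x >> = sym2 A g h :> chain G A 2.
    congr (<< _ >>); apply/ffunP => j; rewrite ffunE.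
    by case: ifPn => [/eqP->//|]; case: j => [[|[|//]] lj] // _;
      congr (x _); apply: val_inj.
  have FD a b e : F (a - b + e) = F a - F b + F e by rewrite raddfD raddfB.
  have piD (a b e d : chain G A 2) : \pi_(relquot A i) (a + (b - e + d)) =
      \pi_(relquot A i) a + (\pi_(relquot A i) b - \pi_(relquot A i) e +
        \pi_(relquot A i) d) by rewrite !raddfD raddfN.
  rewrite bar_diff_sym2 FD piD !piF.
  have -> : (f (g * h)%g).1 = (f g).1 + (f h).1 + cocycle A i g h.
    by rewrite fM -[LHS]/((f g).1 + (f h).1 + cocycle A i (f g).2 (f h).2)
      -[(f g).2]/(taut_ext_pr (f g)) -[(f h).2]/(taut_ext_pr (f h)) !fK.
  have zE (V : zmodType) (a b e : V) : e + (b - (a + b + e) + a) = 0.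
    rewrite [a + b]addrC -[b + a + e]addrA opprD [b + _]addrA subrr add0r opprD.
    by rewrite [- a - e]addrC subrK subrr.
  exact: zE.
elim/quotW: y => z.
have dz : bar_diff (val z) = 0 by apply/eqP; have := valP z; rewrite inE.
have := relF (val z); rewrite dz raddf0 addr0 inE => -[b [d zE]].
(* The retraction makes [chain_map i] injective, so it suffices that the image of [d] is a cycle; it
   differs from [z] by a boundary. *)
have dd : d \in @is_cycle G' A 2.
  have e : chain_map i (bar_diff d) = 0.
    have bD (u v : chain G A 2) : bar_diff (u + v) = bar_diff u + bar_diff v.
      exact: raddfD.
    by rewrite chain_map_bar_diff -[RHS]dz zE bD bar_diffK add0r.
  by rewrite inE -[bar_diff d](chain_mapK iK) e raddf0.
exists (\pi_(homology G' A 2) (Cycle dd)); rewrite homology_map_pi.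
apply/homology_piP; exists (- b); rewrite raddfN /= zE opprD addrCA subrr addr0.
by [].
Qed.

(** * The big cell of PGL_2 *)

Section ProjectiveMatrices.
Variable R : comUnitRingType.
Implicit Types (a b c d x y : R) (A B : 'M[R]_2).

Definition mx2 a b c d : 'M[R]_2 :=
  \matrix_(i, j) if i == 0 then (if j == 0 then a else b)
                 else (if j == 0 then c else d).

Lemma mx2_eqP A B : A 0 0 = B 0 0 -> A 0 1 = B 0 1 -> A 1 0 = B 1 0 ->
  A 1 1 = B 1 1 -> A = B.
Proof.
move=> e00 e01 e10 e11; apply/matrixP => i j.
have two (k : 'I_2) : k = 0 \/ k = 1.
  by case: k => [[|[|//]] lk]; [left | right]; apply: val_inj.
by case: (two i) (two j) => -> [] ->.
Qed.

Lemma mx2_eta A : A = mx2 (A 0 0) (A 0 1) (A 1 0) (A 1 1).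
Proof. by apply: mx2_eqP; rewrite !mxE. Qed.

Lemma mx2M a b c d a' b' c' d' : mx2 a b c d *m mx2 a' b' c' d' =
  mx2 (a * a' + b * c') (a * b' + b * d') (c * a' + d * c') (c * b' + d * d').
Proof.
by apply: mx2_eqP; rewrite !mxE !big_ord_recl big_ord0 !mxE /= addr0.
Qed.

Lemma scale_mx2 x a b c d :
  x *: mx2 a b c d = mx2 (x * a) (x * b) (x * c) (x * d).
Proof. by apply: mx2_eqP; rewrite !mxE. Qed.

Lemma det_mx2 a b c d : \det (mx2 a b c d) = a * d - b * c.
Proof.
rewrite (expand_det_row _ 0) !big_ord_recl big_ord0 /cofactor !det_mx11 !mxE /=.
by rewrite /bump /= !addn0 !addn1; ring.
Qed.

Lemma mx2_1 : mx2 1 0 0 1 = 1%:M.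
Proof. by apply: mx2_eqP; rewrite !mxE. Qed.

(* The class of A in PGL_2, with junk value 1 when A is not invertible. *)
Definition pgl A : PGL 2 R := \pi_(PGL 2 R) (insubd (1%g : GL 2 R) A).

Lemma pglM A B : A \in unitmx -> B \in unitmx ->
  (pgl A * pgl B)%g = pgl (A *m B).
Proof.
move=> uA uB; rewrite PGL_piM; congr (\pi_(PGL 2 R) _); apply: val_inj.
by rewrite /= !val_insubd unitmx_mul uA uB.
Qed.

Lemma pgl_scale x A : x \is a GRing.unit -> pgl (x *: A) = pgl A.
Proof.
move=> ux; have uE : (x *: A \in unitmx) = (A \in unitmx).
  by rewrite !unitmxE detZ unitrM unitrX.
have [uA|nuA] := boolP (A \in unitmx); last first.
  congr (\pi_(PGL 2 R) _); apply: val_inj.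
  by rewrite !val_insubd uE (negPf nuA).
by apply/PGL_piP; exists x; rewrite // !val_insubd uE uA.
Qed.

Lemma pgl1 : pgl 1%:M = 1%g.
Proof.
by congr (\pi_(PGL 2 R) _); apply: val_inj; rewrite val_insubd unitmx1.
Qed.

Lemma pgl_repr (g : PGL 2 R) : pgl (repr g : GL 2 R) = g.
Proof. by rewrite /pgl valKd reprK. Qed.

Lemma pgl_eq_scale A B : A \in unitmx -> B \in unitmx -> pgl A = pgl B ->
  exists2 x, x \is a GRing.unit & A = x *: B.
Proof.
by move=> uA uB /PGL_piP[x ux]; rewrite !val_insubd uA uB; exists x.
Qed.

End ProjectiveMatrices.

Lemma PGL_map_pgl (R S : comUnitRingType) (f : {rmorphism R -> S}) A :
  A \in unitmx -> PGL_map 2 f (pgl A) = pgl (map_mx f A).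
Proof.
move=> uA; rewrite PGL_map_pi; congr (\pi_(PGL 2 S) _); apply: val_inj.
by rewrite /= !val_insubd uA unitmxE det_map_mx rmorph_unit // -unitmxE.
Qed.

Lemma map_mx2 (R S : comUnitRingType) (f : {rmorphism R -> S}) a b c d :
  map_mx f (mx2 a b c d) = mx2 (f a) (f b) (f c) (f d).
Proof. by apply: mx2_eqP; rewrite !mxE. Qed.

(** * Multiplication on the big cell from the unipotent, torus and Weyl relations *)

Section BigCell.
Variables (R : comUnitRingType) (E : groupType) (U H : R -> E) (W : E).
Implicit Types a b c d e x y : R.
Local Notation unit := (GRing.unit : {pred R}).

Hypothesis UD : forall x y, U (x + y) = (U x * U y)%g.
Hypothesis HM :
  forall a b, a \in unit -> b \in unit -> H (a * b) = (H a * H b)%g.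
Hypothesis HU : forall a x, a \in unit -> (H a * U x = U (a * x) * H a)%g.
Hypothesis WH : forall a, a \in unit -> (W * H a = H a^-1%R * W)%g.
Hypothesis WU1W : (W * U 1 * W = U 1 * H (-1) * W * U 1)%g.

Lemma torus1 : H 1 = 1%g.
Proof. by apply: (mulgI (H 1)); rewrite mulg1 -HM ?unitr1 // mulr1. Qed.

Lemma torusV a : a \in unit -> (H a * H a^-1%R = 1)%g.
Proof. by move=> ua; rewrite -HM ?unitrV // divrr // torus1. Qed.

(* Conjugating by H y reduces the relation for y to the one for 1. *)
Lemma weyl_unip_weyl_unit y : y \in unit ->
  (W * U y * W = U y^-1%R * H (- (y^-1 ^+ 2))%R * W * U y^-1%R)%g.
Proof.
move=> uy; have uV : y^-1 \in unit by rewrite unitrV.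
have uN1 : (-1 : R) \in unit by rewrite unitrN unitr1.
have -> : U y = (H y * U 1 * H y^-1%R)%g.
  by rewrite HU // mulr1 -mulgA torusV // mulg1.
have -> : (W * (H y * U 1 * H y^-1%R) * W =
           H y^-1%R * (W * U 1 * W) * H y)%g.
  by rewrite !mulgA WH // -[RHS]mulgA WH // !mulgA.
rewrite WU1W !mulgA HU // mulr1 -!mulgA; congr (_ * _)%g.
have -> : (U 1 * H y = H y * U y^-1%R)%g by rewrite HU // divrr.
rewrite (mulgA W) WH // !mulgA -!HM ?unitrM ?uN1 ?uV //.
by rewrite mulrN1 mulNr expr2.
Qed.

Definition cell a e d : E := (U a * H e * W * U d)%g.

(** Moving [H e'] to the right across [W] isolates [W * U (d + a') * W], which the previous lemma
    rewrites with a single [W]; it remains to collect the unipotent and torus factors. *)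
Lemma cell_mul a e d a' e' d' : e \in unit -> e' \in unit -> d + a' \in unit ->
  let i := (d + a')^-1 in
  (cell a e d * cell a' e' d')%g =
  cell (a + e * i) (- (e * e' * i ^+ 2)) (d' + e' * i).
Proof.
move=> ue ue' uy i; have ui : i \in unit by rewrite unitrV.
have eE : (cell a e d * cell a' e' d' =
    U a * H e * (W * U (d + a') * W) * H e'^-1%R * U d')%g.
  by rewrite /cell UD -!mulgA (mulgA W (H _)) WH ?unitrV // invrK -!mulgA.
have ui2 : - i ^+ 2 \in unit by rewrite unitrN unitrX.
rewrite eE weyl_unip_weyl_unit // -/i /cell UD [d' + _]addrC UD.
have -> : - (e * e' * i ^+ 2) = e * (- i ^+ 2) * e' by ring.
rewrite !HM ?unitrM ?ue //.
have eWU : (W * U i * H e'^-1%R = H e' * W * U (e' * i))%g.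
  rewrite -[in RHS](invrK e') -WH ?unitrV // -!mulgA HU ?unitrV //.
  by rewrite invrK mulKr.
rewrite -!mulgA (mulgA (H e) (U i)) HU // -!mulgA; do 4!congr (_ * _)%g.
by rewrite !mulgA eWU.
Qed.
End BigCell.

(** * Coordinates on the big cell *)

Section Cells.
Variable R : comUnitRingType.
Implicit Types (a d e : R) (A B : 'M[R]_2).
Local Notation unit := (GRing.unit : {pred R}).

(* The Moebius transformation z |-> a + e / (z + d). *)
Definition cell_mx a e d : 'M[R]_2 := mx2 a (e + a * d) 1 d.

Lemma cell_mx_unit a e d : (cell_mx a e d \in unitmx) = (e \in unit).
Proof.
by rewrite unitmxE det_mx2 mulr1 opprD addrCA subrr addr0 unitrN.
Qed.

(** Multiplying a matrix by a unit preserves this condition, so the chosen representative is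
    immaterial. *)
Definition in_big_cell (g : PGL 2 R) : Prop := GL_val (repr g) 1 0 \in unit.

Lemma big_cell_pgl A : A \in unitmx -> in_big_cell (pgl A) <-> A 1 0 \in unit.
Proof.
move=> uA.
have [x ux ->] : exists2 x, x \in unit & A = x *: GL_val (repr (pgl A)).
  by apply: pgl_eq_scale; rewrite ?Defs.GL_unitmx // pgl_repr.
by rewrite mxE unitrM ux pgl_scale // pgl_repr.
Qed.

Lemma cell_mx_big a e d : e \in unit -> in_big_cell (pgl (cell_mx a e d)).
Proof.
by move=> ue; apply/big_cell_pgl; rewrite ?cell_mx_unit // mxE unitr1.
Qed.

(** The arguments of [F] are the coordinates of [g] after scaling the lower left entry to 1; they
    are invariant under unit scalars and meaningful only on the big cell. *)
Definition cell_lift (E : Type) (F : R -> R -> R -> E) (g : PGL 2 R) : E :=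
  let A := GL_val (repr g) in
  F (A 0 0 / A 1 0) (- \det A / A 1 0 ^+ 2) (A 1 1 / A 1 0).

Lemma cell_liftE (E : Type) (F : R -> R -> R -> E) a e d : e \in unit ->
  cell_lift F (pgl (cell_mx a e d)) = F a e d.
Proof.
move=> ue; rewrite /cell_lift; set B := GL_val _.
have [x ux ->] : exists2 x, x \in unit & B = x *: cell_mx a e d.
  apply: pgl_eq_scale; [exact: Defs.GL_unitmx | by rewrite cell_mx_unit |].
  by rewrite pgl_repr.
rewrite detZ det_mx2 !mxE /= !mulr1; congr (F _ _ _).
- by rewrite mulrAC mulrV // mul1r.
- by rewrite -mulrN mulrAC mulrV ?unitrX // mul1r opprB addrK.
- by rewrite mulrAC mulrV // mul1r.
Qed.

Lemma big_cellP g : in_big_cell g ->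
  exists a e d, e \in unit /\ g = pgl (cell_mx a e d).
Proof.
rewrite /in_big_cell -{2}[g]pgl_repr; set A := GL_val _ => uc.
have uA : A \in unitmx by exact: Defs.GL_unitmx.
exists (A 0 0 / A 1 0), (- \det A / A 1 0 ^+ 2), (A 1 1 / A 1 0); split.
  by rewrite unitrM unitrN unitrV unitrX // andbT -unitmxE.
rewrite -[in RHS](pgl_scale _ uc) {1}[A]mx2_eta scale_mx2.
congr (pgl (mx2 _ _ _ _)).
- by rewrite mulrC divrK.
- rewrite [A in \det A]mx2_eta det_mx2.
  set c := A 1 0 in uc *; rewrite -[c ^- 2]exprVn.
  (* [ring] treats [c^-1] as an atom, so the factor [c / c] is kept and simplified afterwards. *)
  have -> : c * (- (A 0 0 * A 1 1 - A 0 1 * c) * c^-1 ^+ 2 +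
      A 0 0 / c * (A 1 1 / c)) = (c / c) ^+ 2 * A 0 1 by ring.
  by rewrite divrr // expr1n mul1r.
- by rewrite mulr1.
- by rewrite mulrC divrK.
Qed.

Lemma cell_mxM a e d a' e' d' : d + a' \in unit ->
  let i := (d + a')^-1 in cell_mx a e d *m cell_mx a' e' d' =
  (d + a') *: cell_mx (a + e * i) (- (e * e' * i ^+ 2)) (d' + e' * i).
Proof.
move=> uy i; have : (d + a') * i = 1 by rewrite mulrV.
have -> : a' = (d + a') - d by rewrite addrC addKr.
move: i (d + a') uy => i y _; rewrite [d + _]addrC subrK => yi.
rewrite mx2M scale_mx2; apply: mx2_eqP; rewrite !mxE /=.
- by ring: yi.
- by ring: yi.
- by ring: yi.
- by ring: yi.
Qed.

Lemma pgl_cellM a e d a' e' d' : e \in unit -> e' \in unit -> d + a' \in unit ->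
  let i := (d + a')^-1 in
  (pgl (cell_mx a e d) * pgl (cell_mx a' e' d'))%g =
  pgl (cell_mx (a + e * i) (- (e * e' * i ^+ 2)) (d' + e' * i)).
Proof.
by move=> ue ue' uy i; rewrite pglM ?cell_mx_unit // cell_mxM // pgl_scale.
Qed.

(** The lower left entry of the product is [d + a'], so a product that stays in the big cell is
    always covered by [cell_mul]. *)
Lemma big_cell_mul a e d a' e' d' : e \in unit -> e' \in unit ->
  in_big_cell (pgl (cell_mx a e d) * pgl (cell_mx a' e' d'))%g ->
  d + a' \in unit.
Proof.
move=> ue ue'; rewrite pglM ?cell_mx_unit // big_cell_pgl; last first.
  by rewrite unitmx_mul !cell_mx_unit ue.
by rewrite mx2M mxE /= mul1r mulr1 addrC.
Qed.

End Cells.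

(** * Standard generators of PGL_2 and their relations *)

Section StandardElements.
Variable R : comUnitRingType.
Implicit Types a x y : R.
Local Notation unit := (GRing.unit : {pred R}).

Definition unip x : PGL 2 R := pgl (mx2 1 x 0 1).
Definition dil a : PGL 2 R := pgl (mx2 a 0 0 1).
Definition weyl : PGL 2 R := pgl (mx2 0 1 1 0).

Lemma unip_unitmx x : mx2 1 x 0 1 \in unitmx.
Proof. by rewrite unitmxE det_mx2 mulr0 subr0 mulr1 unitr1. Qed.

Lemma dil_unitmx a : (mx2 a 0 0 1 \in unitmx) = (a \in unit).
Proof. by rewrite unitmxE det_mx2 mulr0 subr0 mulr1. Qed.

Lemma weyl_unitmx : mx2 0 1 1 0 \in @unitmx R 2.
Proof. by rewrite unitmxE det_mx2 mulr0 sub0r mulr1 unitrN unitr1. Qed.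

Let mxU := (unip_unitmx, dil_unitmx, weyl_unitmx, unitmx_mul).

Lemma unipD x y : unip (x + y) = (unip x * unip y)%g.
Proof.
rewrite pglM ?mxU // mx2M; congr (pgl (mx2 _ _ _ _)); ring.
Qed.

Lemma unip_exp x n : (unip x ^+ n)%g = unip (x *+ n).
Proof.
elim: n => [|n IHn]; first by rewrite mulr0n /unip mx2_1 pgl1.
by rewrite expgS IHn -unipD mulrS.
Qed.

Lemma dilM a b : a \in unit -> b \in unit -> dil (a * b) = (dil a * dil b)%g.
Proof.
move=> ua ub; rewrite pglM ?mxU ?ua //.
rewrite mx2M; congr (pgl (mx2 _ _ _ _)); ring.
Qed.

Lemma dil1 : dil 1 = 1%g.
Proof. by rewrite /dil mx2_1 pgl1. Qed.

Lemma dil_exp a n : a \in unit -> (dil a ^+ n)%g = dil (a ^+ n).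
Proof.
move=> ua; elim: n => [|n IHn]; first by rewrite expr0 dil1.
by rewrite expgS IHn -dilM ?unitrX // exprS.
Qed.

Lemma dil_unip a x : a \in unit ->
  (dil a * unip x)%g = (unip (a * x)%R * dil a)%g.
Proof.
move=> ua; rewrite !pglM ?mxU // !mx2M; congr (pgl (mx2 _ _ _ _)); ring.
Qed.

Lemma weyl_dil a : a \in unit -> (weyl * dil a)%g = (dil a^-1%R * weyl)%g.
Proof.
(* The two matrices agree only up to the scalar [a]. *)
move=> ua; rewrite !pglM ?mxU ?unitrV // !mx2M -[RHS](pgl_scale _ ua).
by rewrite scale_mx2 !(mulr0, mul0r, mulr1, mul1r, addr0, add0r) mulrV.
Qed.

(** Both sides are the lower unitriangular matrix with entry 1. *)
Lemma weyl_unip_weyl : (weyl * unip 1 * weyl)%g =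
  (unip 1 * dil (-1)%R * weyl * unip 1)%g.
Proof.
rewrite !pglM ?mxU ?unitrN ?unitr1 // !mx2M.
congr (pgl (mx2 _ _ _ _)); ring.
Qed.

Lemma cell_std a e d : e \in unit ->
  cell unip dil weyl a e d = pgl (cell_mx a e d).
Proof.
move=> ue; rewrite /cell !pglM ?mxU ?ue // !mx2M.
congr (pgl (mx2 _ _ _ _)); ring.
Qed.

End StandardElements.

Section StandardElementsMap.
Variables (R S : comUnitRingType) (f : {rmorphism R -> S}).

Lemma PGL_map_unip x : PGL_map 2 f (unip x) = unip (f x).
Proof.
by rewrite PGL_map_pgl ?unip_unitmx // map_mx2 rmorph0 rmorph1.
Qed.

Lemma PGL_map_dil a : a \is a GRing.unit -> PGL_map 2 f (dil a) = dil (f a).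
Proof.
by move=> ua; rewrite PGL_map_pgl ?dil_unitmx // map_mx2 rmorph0 rmorph1.
Qed.

Lemma PGL_map_weyl : PGL_map 2 f (weyl R) = weyl S.
Proof. by rewrite PGL_map_pgl ?weyl_unitmx // map_mx2 rmorph0 rmorph1. Qed.

End StandardElementsMap.

(** * Splitting central extensions of PGL_2 *)

Section Splitting.
Variables (k : fieldType) (R : comUnitRingType).
Variables (incl : {rmorphism k -> R}) (rho : {rmorphism R -> k}) (p : nat).
Hypothesis inclK : cancel incl rho.
Hypothesis rho_unit : forall x, rho x != 0 -> x \is a GRing.unit.
Hypothesis p_neq0 : p%:R != 0 :> k.
Variable rt : R -> R.
Hypothesis rtP : forall v, rho v = 1 -> rho (rt v) = 1 /\ rt v ^+ p = v.
Hypothesis k_inf : forall s : seq k, exists t, t \notin s.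
Local Notation unit := (GRing.unit : {pred R}).

Lemma unit_rho x : (x \in unit) = (rho x != 0).
Proof.
apply/idP/idP => [ux|]; last exact: rho_unit.
by rewrite -unitfE rmorph_unit.
Qed.

(** The cofactor of [x - y] in [x ^+ p - y ^+ p] has residue [p%:R], hence is a unit. *)
Lemma root_uniq x y : rho x = 1 -> rho y = 1 -> x ^+ p = y ^+ p -> x = y.
Proof.
move=> x1 y1 /eqP; rewrite -subr_eq0 subrXX => /eqP e.
have u : \sum_(i < p) x ^+ (p.-1 - i) * y ^+ i \in unit.
  rewrite unit_rho rmorph_sum /= (eq_bigr (fun=> 1)).
    by rewrite sumr_const card_ord.
  by move=> i _; rewrite rmorphM !rmorphXn /= x1 y1 !expr1n mulr1.
apply/eqP; rewrite -subr_eq0; apply/eqP; apply: (mulIr u).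
by rewrite mul0r.
Qed.

(* The component in 1 + m for the decomposition R^* = k^* x (1 + m). *)
Definition one_part a : R := a / incl (rho a).

Lemma incl_unit c : (incl c \in unit) = (c != 0).
Proof. by rewrite unit_rho inclK. Qed.

Lemma rho_one_part a : a \in unit -> rho (one_part a) = 1.
Proof.
move=> ua; have c0 : rho a != 0 by rewrite -unit_rho.
by rewrite rmorphM rmorphV ?incl_unit //= inclK divff.
Qed.

Lemma one_partE a : a \in unit -> incl (rho a) * one_part a = a.
Proof.
by move=> ua; rewrite mulrC divrK // incl_unit -unit_rho.
Qed.

Lemma one_partM a b : a \in unit -> b \in unit ->
  one_part (a * b) = one_part a * one_part b.
Proof.
move=> ua ub; rewrite /one_part !rmorphM /= invrM ?incl_unit -?unit_rho //.
by rewrite [X in _ * X]mulrC mulrACA.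
Qed.

(** The translating element is the class of the matrix with rows (t, 1) and (1, 0). If g has lower
    row (c, d), the lower left entry of the product is c t + d, whose residue vanishes for at most
    one t in [k]. *)
Lemma big_cell_generic (g1 g2 g3 : PGL 2 R) : exists h,
  [/\ in_big_cell h, in_big_cell (g1 * h)%g, in_big_cell (g2 * h)%g
    & in_big_cell (g3 * h)%g].
Proof.
(* When the lower left residue is 0 this is the default value 0; every t then works, since the lower
   right residue is nonzero. *)
pose bad (g : PGL 2 R) :=
  - (rho (GL_val (repr g) 1 1) / rho (GL_val (repr g) 1 0)).
have [t] := k_inf [:: bad g1; bad g2; bad g3].
rewrite !inE !negb_or => /and3P[t1 t2 t3].
have good (g : PGL 2 R) : t != bad g ->
    in_big_cell (g * pgl (cell_mx (incl t) 1 0))%g.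
  rewrite -{2}[g]pgl_repr /bad; set A := GL_val _ => tg.
  have uA : A \in unitmx by exact: Defs.GL_unitmx.
  have uc : cell_mx (incl t) 1 0 \in unitmx by rewrite cell_mx_unit unitr1.
  rewrite pglM // big_cell_pgl ?unitmx_mul ?uA //.
  rewrite [A]mx2_eta mx2M mxE /= mulr1 unit_rho rmorphD rmorphM /= inclK.
  have [c0|c0] := eqVneq (rho (A 1 0)) 0.
    rewrite c0 mul0r add0r; apply: contraTneq uA => d0.
    by rewrite unitmxE [A]mx2_eta det_mx2 unit_rho rmorphB !rmorphM /= c0 d0
      !mulr0 subrr eqxx.
  apply: contraNneq tg => e0; apply/eqP/(mulfI c0).
  by rewrite mulrN mulrC [in RHS]mulrC divfK // [LHS]mulrC; apply/eqP;
     rewrite -addr_eq0 e0.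
exists (pgl (cell_mx (incl t) 1 0)); split; try exact: good.
by apply: cell_mx_big; rewrite unitr1.
Qed.

Variables (E : groupType) (pr : UMagmaMorphism.type E (PGL 2 R)).
Variables (l : PGL 2 R -> E) (s : UMagmaMorphism.type (PGL 2 k) E).
Hypothesis lK : cancel l pr.
Hypothesis ker_central : forall z e : E, pr z = 1%g -> commute z e.
Hypothesis ker_torsion : forall z : E, pr z = 1%g -> (z ^+ p = 1)%g.
Hypothesis sK : forall g, pr (s g) = PGL_map 2 incl g.

Local Notation Q := (lift_pow p l).
Let QM := lift_powM lK ker_central ker_torsion.
Let Qtw := lift_pow_intertwine lK ker_central ker_torsion.
Let QE := lift_powE lK ker_central ker_torsion.

(** Dividing by p makes the p-th power of a lift project to [unip x] itself. *)
Definition lift_unip (x : R) : E := Q (unip (x / p%:R)).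
Let W : E := s (weyl k).

Lemma p_unit : (p%:R : R) \is a GRing.unit.
Proof. by rewrite unit_rho rmorph_nat. Qed.

Lemma divp_mul (x : R) : x / p%:R *+ p = x.
Proof. by rewrite -mulr_natr divrK // p_unit. Qed.

Lemma pr_lift_unip x : pr (lift_unip x) = unip x.
Proof. by rewrite (pr_lift_pow p lK) unip_exp divp_mul. Qed.

Lemma lift_unipD x y : lift_unip (x + y) = (lift_unip x * lift_unip y)%g.
Proof.
rewrite /lift_unip mulrDl unipD -[x / _ in LHS]divp_mul -unip_exp QM.
  by rewrite unip_exp divp_mul.
by rewrite /commute -!unipD addrC.
Qed.

Lemma lift_unip1 : lift_unip 1 = s (unip 1).
Proof.
have -> : unip 1 = (unip (p%:R^-1 : k) ^+ p)%g.
  by rewrite unip_exp -[p%:R^-1 *+ p]mulr_natr mulVf.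
rewrite gmulfXn QE sK PGL_map_unip fmorphV rmorph_nat.
by rewrite /lift_unip mul1r.
Qed.

Definition lift_dil a : E := (s (dil (rho a)) * Q (dil (rt (one_part a))))%g.

Lemma rt_one_part a : a \in unit -> rt (one_part a) \in unit.
Proof.
by move=> ua; rewrite unit_rho (rtP (rho_one_part ua)).1 oner_neq0.
Qed.

Lemma rt_uniq v r : rho v = 1 -> rho r = 1 -> r ^+ p = v -> rt v = r.
Proof.
by move=> v1 r1 rv; have [t1 tv] := rtP v1; apply: root_uniq; rewrite // rv.
Qed.

Lemma pr_lift_dil a : a \in unit -> pr (lift_dil a) = dil a.
Proof.
move=> ua; have c0 : rho a != 0 by rewrite -unit_rho.
rewrite gmulfM sK PGL_map_dil ?unitfE // (pr_lift_pow p lK).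
rewrite dil_exp ?rt_one_part // (rtP (rho_one_part ua)).2 -dilM ?one_partE //.
  by rewrite incl_unit.
by rewrite unit_rho rho_one_part // oner_neq0.
Qed.

Lemma commute_dil a b : a \in unit -> b \in unit -> commute (dil a) (dil b).
Proof. by move=> ua ub; rewrite /commute -!dilM // mulrC. Qed.

Lemma lift_dilM a b : a \in unit -> b \in unit ->
  lift_dil (a * b) = (lift_dil a * lift_dil b)%g.
Proof.
move=> ua ub; have [a0 b0] : rho a != 0 /\ rho b != 0 by rewrite -!unit_rho.
have [ra1 raE] := rtP (rho_one_part ua).
have [rb1 rbE] := rtP (rho_one_part ub).
have ura := rt_one_part ua; have urb := rt_one_part ub.
rewrite /lift_dil (rt_uniq (r := rt (one_part a) * rt (one_part b)));
  first last.
- by rewrite exprMn raE rbE one_partM.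
- by rewrite rmorphM /= ra1 rb1 mulr1.
- by rewrite rho_one_part // unitrM ua.
rewrite rmorphM [dil (rho a * _)]dilM ?unitfE // [s (_ * _)%g]gmulfM dilM //.
have [sa1 saE] := rtP ra1.
have usa : rt (rt (one_part a)) \in unit by rewrite unit_rho sa1 oner_neq0.
have -> : Q (dil (rt (one_part a)) * dil (rt (one_part b))) =
    (Q (dil (rt (one_part a))) * Q (dil (rt (one_part b))))%g.
  by rewrite -[in LHS]saE -dil_exp // QM ?dil_exp ?saE //; exact: commute_dil.
rewrite -!mulgA; congr (_ * _)%g; rewrite !mulgA; congr (_ * _)%g.
apply: Qtw; rewrite sK PGL_map_dil ?unitfE //.
by apply: commute_dil; rewrite // incl_unit.
Qed.

Lemma lift_dil_unip a x : a \in unit ->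
  (lift_dil a * lift_unip x = lift_unip (a * x) * lift_dil a)%g.
Proof.
by move=> ua; apply: Qtw; rewrite pr_lift_dil // dil_unip // mulrA.
Qed.

Lemma weyl_lift_dil a : a \in unit -> (W * lift_dil a = lift_dil a^-1%R * W)%g.
Proof.
move=> ua; have a0 : rho a != 0 by rewrite -unit_rho.
have [ra1 raE] := rtP (rho_one_part ua); have ura := rt_one_part ua.
have e : one_part a^-1 = (one_part a)^-1.
  have uo : one_part a \in unit by rewrite unit_rho rho_one_part ?oner_neq0.
  apply: (mulrI uo); rewrite -one_partM ?unitrV // !divrr //.
  by rewrite /one_part !rmorph1 divr1.
rewrite /lift_dil (rt_uniq (v := one_part a^-1) (r := (rt (one_part a))^-1));
  first last.
- by rewrite exprVn raE e.
- by rewrite rmorphV //= ra1 invr1.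
- by rewrite rho_one_part // unitrV.
rewrite mulgA -gmulfM weyl_dil ?unitfE // gmulfM rmorphV //= -!mulgA.
congr (_ * _)%g; apply: Qtw; rewrite sK PGL_map_weyl weyl_dil //.
Qed.

Lemma lift_dilN1 : lift_dil (-1) = s (dil (-1)).
Proof.
rewrite /lift_dil rmorphN rmorph1 /one_part rmorphN !rmorph1 rmorphN rmorph1.
rewrite divrr ?unitrN ?unitr1 // (rt_uniq (r := 1)) ?rmorph1 ?expr1n //.
by rewrite dil1 (lift_pow1 lK ker_central ker_torsion) mulg1.
Qed.

Lemma weyl_lift_unip_weyl : (W * lift_unip 1 * W =
  lift_unip 1 * lift_dil (-1)%R * W * lift_unip 1)%g.
Proof. by rewrite lift_unip1 lift_dilN1 -!gmulfM weyl_unip_weyl. Qed.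

Lemma pr_cell a e d : e \in unit ->
  pr (cell lift_unip lift_dil W a e d) = pgl (cell_mx a e d).
Proof.
move=> ue; rewrite /cell 3!gmulfM !pr_lift_unip pr_lift_dil // sK PGL_map_weyl.
by rewrite -cell_std.
Qed.

Lemma PGL2_section : exists2 f : PGL 2 R -> E,
  {morph f : x y / (x * y)%g} & cancel f pr.
Proof.
pose S := cell_lift (cell lift_unip lift_dil W).
have prS x : in_big_cell x -> pr (S x) = x.
  by move=> /big_cellP[a [e [d [ue ->]]]]; rewrite /S cell_liftE // pr_cell.
have SM x y : in_big_cell x -> in_big_cell y -> in_big_cell (x * y)%g ->
    S (x * y)%g = (S x * S y)%g.
  move=> /big_cellP[a [e [d [ue ->]]]] /big_cellP[a' [e' [d' [ue' ->]]]].
  move=> /(big_cell_mul ue ue') uy; rewrite pgl_cellM // /S !cell_liftE //.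
    rewrite cell_mul //; [exact: lift_unipD | exact: lift_dilM
      | exact: lift_dil_unip | exact: weyl_lift_dil
      | exact: weyl_lift_unip_weyl].
  by rewrite unitrN !unitrM ue ue' !unitrV uy.
have [f [fM fE]] := group_chunk SM big_cell_generic.
exists f => // g; have [h [bh bgh _ _]] := big_cell_generic g 1%g 1%g.
by rewrite (fE g h) // gmulfF !prS // mulgK.
Qed.

End Splitting.

(** * Henselian local rings *)

Section LocalRing.
Local Open Scope classical_set_scope.

Lemma local_ring_unit (R : comUnitRingType) (m : {pred R}) x :
  local_ring m -> x \notin m -> x \is a GRing.unit.
Proof.
move=> [_ uniq_m]; apply: contraNT => nux.
(* The empty set is allowed so that unions of empty chains qualify. *)
pose P : set (set R) := [set S | [/\ forall y, S y -> S x, ~ S 1 &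
  forall a u v, S u -> S v -> S (a * u + v)]].
have [A [[Ax A1 AD] maxA]] : exists A, P A /\ forall B, A `<` B -> ~ P B.
  apply: Zorn_bigcup => F FP Ftot; split.
  - move=> y [S FS Sy]; exists S => //.
    by have [+ _ _] := FP _ FS; apply; exact: Sy.
  - by move=> [S FS S1]; have [_ + _] := FP _ FS; exact.
  move=> a u v [S FS Su] [T FT Tv].
  have [ST|TS] := Ftot _ _ FS FT.
    by exists T => //; have [_ _] := FP _ FT; apply; [exact: ST|].
  by exists S => //; have [_ _] := FP _ FS; apply; [|exact: TS].
have {}Ax : A x.
  apply: contrapT => nAx; apply: (maxA [set y | exists a, y = a * x]).
    split; last by move=> /(_ x) sub; apply/nAx/sub; exists 1; rewrite mul1r.
    by move=> y /Ax.
  split=> [y _||a u v [b ->] [c ->]].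
  - by exists 1; rewrite mul1r.
  - move=> [a a1]; move/negP: nux; apply; apply/unitrPr.
    by exists a; rewrite mulrC.
  - by exists (a * b + c); rewrite mulrDl mulrA.
pose J : {pred R} := [pred y | `[< A y >]].
suff : J =i m by move=> <-; rewrite inE.
apply: uniq_m; split.
  split; rewrite ?inE.
  - by have := AD (-1) _ _ Ax Ax; rewrite mulN1r addNr.
  - by apply/asboolP.
  - by move=> a u v; rewrite !inE; exact: AD.
move=> K [K0 K1 KD] JK y; apply/idP/idP; last exact: JK.
move=> Ky; apply: contrapT => nJy; apply: (maxA [set z | z \in K]).
  split; first by move=> z Az; apply: JK; rewrite inE.
  by move=> /(_ y Ky) Ay; apply: nJy; rewrite inE.
split=> [z _||a u v].
- by apply: JK; rewrite inE.
- by apply/negP.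
- exact: KD.
Qed.

End LocalRing.

Section Residue.
Variables (k : fieldType) (R : comUnitAlgType k) (m : idealr R).
Local Notation const := (fun c : k => \pi_{ideal_quot m} (c%:A : R)).
Variable g : {ideal_quot m} -> k.
Hypotheses (constK : cancel const g) (gK : cancel g const).

Definition residue (x : R) : k := g (\pi_{ideal_quot m} x).

Lemma residueB : zmod_morphism residue.
Proof.
move=> x y; apply: (can_inj constK).
by rewrite gK scalerBl !raddfB /= !gK.
Qed.

Lemma residueM : monoid_morphism residue.
Proof.
split=> [|x y]; apply: (can_inj constK); first by rewrite gK scale1r.
have algM (a b : k) : (a * b)%:A = a%:A * b%:A :> R.
  exact: (rmorphM (in_alg R)).
by rewrite gK algM !rmorphM /= !gK.
Qed.

HB.instance Definition _ := GRing.isZmodMorphism.Build R k residue residueB.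
HB.instance Definition _ := GRing.isMonoidMorphism.Build R k residue residueM.

Lemma residue_rmorphism : exists rho : {rmorphism R -> k}, rho =1 residue.
Proof. by exists residue. Qed.

Lemma residue_alg : cancel (in_alg R) residue.
Proof. exact: constK. Qed.

Lemma residue_eq0 x : x \in m -> residue x = 0.
Proof.
move=> xm; rewrite -(rmorph0 residue); congr (g _); apply/eqP.
by rewrite -Quotient.idealrBE subr0.
Qed.

Lemma residue_eq1 x : residue x = 1 -> \pi_{ideal_quot m} x = 1.
Proof.
by move=> x1; rewrite -[LHS]gK -/(residue x) x1 scale1r rmorph1.
Qed.

Lemma henselian_root p v : henselian_local_ring m -> (0 < p)%N ->
  p%:R != 0 :> k -> residue v = 1 -> exists2 r, residue r = 1 & r ^+ p = v.
Proof.
move=> [_ hens] p_gt0 p0 v1.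
have [||r rootr r1] := hens ('X^p - v%:P) 1 (monicXnsubC _ p_gt0).
- rewrite rmorphB /= map_polyXn map_polyC /= residue_eq1 // rootE.
  by rewrite !hornerE expr1n subrr.
- rewrite rmorphB /= map_polyXn map_polyC /= derivB derivC subr0 derivXn.
  rewrite rootE hornerMn hornerXn expr1n; apply: contra_neq p0 => p0.
  by apply: (can_inj constK); rewrite !scaler_nat scale0r rmorph0 rmorph_nat.
exists r.
  by apply: etrans (rmorph1 residue); congr (g _); rewrite r1 rmorph1.
by apply/eqP; move: rootr; rewrite rootE hornerD hornerN hornerXn hornerC
  subr_eq0.
Qed.

End Residue.

Lemma infinite_avoid (T : choiceType) : infinite_set [set: T]%classic ->
  forall s : seq T, exists t, t \notin s.
Proof.
move=> inf s; apply: contrapT => ex; apply: inf; apply/finite_seqP; exists s.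
apply/seteqP; split=> // t _ /=; apply: contrapT => /negP ts.
by apply: ex; exists t.
Qed.

Theorem corollary3p5 (k : fieldType) (R : comUnitAlgType k) (m : idealr R)
    (p : nat) :
  infinite_set [set: k]%classic ->
  henselian_local_ring m ->
  bijective (fun c : k => \pi_{ideal_quot m} (c%:A : R)) ->
  prime p -> p \notin [pchar k] ->
  bijective (homology_map 'F_p (PGL_map 2 (in_alg R)) 2).
Proof.
move=> k_inf hens [g constK gK] p_pr p_char.
have [rho rhoE] := residue_rmorphism constK gK.
have p0 : p%:R != 0 :> k by move: p_char; rewrite inE p_pr.
have rho_unit x : rho x != 0 -> x \is a GRing.unit.
  move=> x0; apply: (local_ring_unit hens.1); apply: contraNN x0 => xm.
  by rewrite rhoE (residue_eq0 constK gK).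
have /choice[rt rtP] : forall v, exists r, rho v = 1 -> rho r = 1 /\ r ^+ p = v.
  move=> v; have [v1|v1] := eqVneq (residue g v) 1; last first.
    by exists 0; rewrite rhoE => v1'; rewrite v1' eqxx in v1.
  have [r r1 rv] := henselian_root constK gK hens (prime_gt0 p_pr) p0 v1.
  by exists r; rewrite !rhoE.
have incK : cancel (in_alg R) rho.
  by move=> c; rewrite rhoE (residue_alg constK).
have rtr : cancel (PGL_map 2 (in_alg R)) (PGL_map 2 rho).
  move=> x; rewrite -[x]pgl_repr; have uA := Defs.GL_unitmx (repr x).
  rewrite !PGL_map_pgl ?unitmxE ?det_map_mx ?rmorph_unit -?unitmxE //.
  congr (pgl _); apply/matrixP => i j; rewrite !mxE.
  exact: incK.
have inj := @homology_map_inj 'F_p _ _ _ _ 2 rtr.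
have /choice[h hK] := homology2_surjective (A := 'F_p) rtr (pchar_Fp_0 p_pr)
  (fun E pr l s lK kc kt sK => PGL2_section
    incK rho_unit p0 rtP (infinite_avoid k_inf) lK kc kt sK).
by exists h => // x; apply: inj; rewrite hK.
Qed.
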